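(* Let $n \geq 1$ and $r \geq 2$ be integers. For any graph $F$, there is a constant $C = C(r,F)$, depending only on $r$ and $F$, such that $$\mathrm{sat}(n,K_r,F) < Cn.$$
   Context: All graphs are finite and simple. A graph $G$ is $F$-free if it contains no (not necessarily induced) subgraph isomorphic to $F$. $G$ is $F$-saturated if $G$ is $F$-free but adding any nonedge to $G$ creates at least one copy of $F$. A copy of $H$ in $G$ is a (not necessarily induced) subgraph of $G$ isomorphic to $H$. $\mathrm{sat}(n,H,F)$ denotes the minimum number of copies of $H$ in an $n$-vertex $F$-saturated graph. $K_m$ is the complete graph on $m$ vertices. *)

(* Defs.v *)
From HB Require Import structures.
From mathcomp Require Import all_boot.

Set Implicit Arguments.
Unset Strict Implicit.
Unset Printing Implicit Defensive.

Record sgraph (V : finType) := SGraph {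
  edges : {set {set V}};
  edges_card2 : [forall e in edges, #|e| == 2]
}.

HB.instance Definition _ (V : finType) := [isSub for @edges V].
HB.instance Definition _ (V : finType) := [Finite of sgraph V by <:].

Lemma pairs_card2 (V : finType) (A : {set {set V}}) :
  [forall e in [set e in A | #|e| == 2], #|e| == 2].
Proof. by apply/forall_inP => e; rewrite inE => /andP[]. Qed.

Definition graph_of (V : finType) (A : {set {set V}}) : sgraph V :=
  SGraph (pairs_card2 A).

Definition complete (m : nat) : sgraph 'I_m := graph_of [set: {set 'I_m}].

Definition add_edge (V : finType) (G : sgraph V) (e : {set V}) : sgraph V :=
  graph_of (e |: edges G).

(* A copy is a subgraph, recorded as its (vertex set, edge set), so that
   embeddings differing by an automorphism of H give the same copy. *)
Definition is_copy (U V : finType) (H : sgraph U) (G : sgraph V)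
    (S : {set V} * {set {set V}}) : bool :=
  (S.2 \subset edges G) &&
  [exists f : {ffun U -> V},
     [&& injectiveb f, S.1 == f @: [set: U]
       & S.2 == [set f @: e | e : {set U} in edges H]]].

Definition copies (U V : finType) (H : sgraph U) (G : sgraph V) : nat :=
  #|[set S | is_copy H G S]|.

Definition free (U V : finType) (F : sgraph U) (G : sgraph V) : bool :=
  ~~ [exists S, is_copy F G S].

Definition saturated (U V : finType) (F : sgraph U) (G : sgraph V) : bool :=
  free F G &&
  [forall e : {set V}, (#|e| == 2) && (e \notin edges G) ==>
     ~~ free F (add_edge G e)].

(* The value 0 is a convention for an empty minimum. By saturated_exists it
   can only be used when F has no edge. *)
Definition sat (U W : finType) (n : nat) (H : sgraph U) (F : sgraph W) : nat :=
  if [pick G : sgraph 'I_n | saturated F G] is Some G0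
  then copies H [arg min_(G < G0 | saturated F G) copies H G]
  else 0.

Lemma saturated_exists (W V : finType) (F : sgraph W) :
  edges F != set0 -> exists G : sgraph V, saturated F G.
Proof.
case/set0Pn => e0 e0F.
have free0 : free F (graph_of (set0 : {set {set V}})).
  apply/existsP => -[[A B]] /andP[/= sB /existsP[f /and3P[_ _ /eqP defB]]].
  have /(subsetP sB) : f @: e0 \in B by rewrite defB imset_f.
  by rewrite !inE.
case: (arg_maxnP (fun G : sgraph V => #|edges G|) free0) => G freeG maxG.
exists G; rewrite /saturated freeG; apply/forall_inP => e /andP[e2 eG].
apply/negP => /maxG; suff -> : edges (add_edge G e) = e |: edges G.
  by rewrite cardsU1 eG add1n /= ltnn.
apply/setP => x; rewrite !inE; case: eqP => [-> //|_] /=.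
by case xG: (x \in _) => //=; apply: (forall_inP (edges_card2 G)).
Qed.

(* Main.v *)
Require Import Defs.
From mathcomp Require Import all_boot.

(** Suppose that [F] has an edge, let [S] be a largest independent set of [F]
    and put [u = #|W| - #|S| - 1].  The graph [cone A] of all pairs that meet a
    set [A] of at most [u] vertices is [F]-free: a copy of [F] in it would have
    at least [#|S| + 1] vertices outside [A], and these would be independent
    ([cone_free]).  Extend it to an [F]-saturated graph [G]
    ([saturated_extension]).

    When [A] has exactly [u] vertices, the part of [G] outside [A] has all
    degrees less than [#|S|]: given a vertex [v] of larger degree, [F] could be
    embedded by sending one vertex [x] outside [S] to [v], [S] to neighbours of
    [v], and the [u] other vertices to [A], which is joined to everything
    ([outer_degree]).  When [A] has fewer, because [n < u], let it be the whole
    vertex set, so that nothing lies outside it.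
    So a clique of [G] is a subset of [A] together with a clique in a graph of
    bounded degree, and there are only linearly many of these
    ([card_cliques]).

    If [F] has no edge, it is contained in every graph with at least [#|W|]
    vertices; then saturated graphs exist only for [n < #|W|]
    ([sat_edgeless]). *)

Set Implicit Arguments.
Unset Strict Implicit.
Unset Printing Implicit Defensive.

(** * Copies and saturation *)

Lemma edge_card (V : finType) (G : sgraph V) e : e \in edges G -> #|e| = 2.
Proof. by move=> eG; apply/eqP/(forall_inP (edges_card2 G)). Qed.

Lemma not_freeP (U V : finType) (F : sgraph U) (G : sgraph V) :
  reflect (exists2 f : U -> V, injective f &
             forall e, e \in edges F -> f @: e \in edges G)
          (~~ free F G).
Proof.
rewrite negbK; apply: (iffP existsP) => [[S]|[f injf fE]].
  case/andP=> /subsetP sub /existsP[f /and3P[/injectiveP injf _ /eqP defS]].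
  by exists f => // e eF; apply: sub; rewrite defS imset_f.
have fE' (e : {set U}) : finfun f @: e = f @: e.
  by apply: eq_imset => x; rewrite ffunE.
exists (finfun f @: [set: U], [set finfun f @: e | e : {set U} in edges F]).
apply/andP; split => /=.
  by apply/subsetP => _ /imsetP[e eF ->]; rewrite fE' fE.
apply/existsP; exists (finfun f); rewrite !eqxx !andbT.
by apply/injectiveP => x y; rewrite !ffunE; apply: injf.
Qed.

(** An [F]-free supergraph of [G0] with the largest number of edges is
    saturated. *)
Lemma saturated_extension (U V : finType) (F : sgraph U) (G0 : sgraph V) :
  free F G0 -> exists2 G, saturated F G & edges G0 \subset edges G.
Proof.
move=> free0; pose P (G : sgraph V) := free F G && (edges G0 \subset edges G).
have P0 : P G0 by rewrite /P free0 subxx.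
case: (arg_maxnP (fun G => #|edges G|) P0) => G /andP[freeG subG] maxG.
exists G => //; rewrite /saturated freeG; apply/forall_inP => e /andP[e2 eG].
have defE : edges (add_edge G e) = e |: edges G.
  apply/setP => x; rewrite !inE; case: eqP => [-> //|_] /=.
  by case xG: (x \in _) => //=; rewrite (edge_card xG).
apply/negP => free_e; have := maxG (add_edge G e).
rewrite /P free_e defE (subset_trans subG (subsetUr _ _)) cardsU1 eG add1n /=.
by move/(_ isT); rewrite ltnn.
Qed.

Lemma sat_le_copies (U W : finType) n (H : sgraph U) (F : sgraph W)
    (G : sgraph 'I_n) :
  saturated F G -> sat n H F <= copies H G.
Proof.
move=> satG; rewrite /sat; case: pickP => [G0 satG0|/(_ G)]; last by rewrite satG.
by case: arg_minnP => // G1 _; apply.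
Qed.

(** * Counting cliques *)

Definition clique (V : finType) (G : sgraph V) (X : {set V}) : bool :=
  [forall e : {set V}, (e \subset X) && (#|e| == 2) ==> (e \in edges G)].

(** A copy of a complete graph is determined by its vertex set, since its edges
    are all the pairs of its vertices. *)
Lemma copies_complete (V : finType) r (G : sgraph V) :
  copies (complete r) G <= #|[set X | clique G X]|.
Proof.
have copyE S e : is_copy (complete r) G S ->
    (e \in S.2) = (e \subset S.1) && (#|e| == 2).
  case/andP=> _ /existsP[f /and3P[/injectiveP injf /eqP -> /eqP ->]].
  apply/imsetP/andP => [[a + ->]|[/subsetP sub e2]].
    rewrite !inE /= => a2; rewrite card_imset // a2; split=> //.
    exact/imsetS/subsetT.
  have defe : f @: (f @^-1: e) = e.
    apply/setP => y; apply/imsetP/idP => [[x]|ye]; first by rewrite inE => ? ->.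
    by have /imsetP[x _ defy] := sub y ye; exists x => //; rewrite inE -defy.
  exists (f @^-1: e) => //.
  by rewrite !inE -(card_imset _ injf) defe.
rewrite /copies -(card_in_imset (f := fst)).
  apply: subset_leq_card; apply/subsetP => _ /imsetP[S + ->].
  rewrite !inE => cS; apply/forall_inP => e; rewrite -(copyE _ _ cS).
  by case/andP: cS => /subsetP sub _; apply: sub.
move=> [X E] [X' E'] /[!inE] cS cS' /= eqX.
congr (_, _) => //; apply/setP => e.
by rewrite (copyE _ e cS) (copyE _ e cS') /= eqX.
Qed.

Lemma cliques_le (V : finType) (G : sgraph V) :
  #|[set X | clique G X]| <= 2 ^ #|V|.
Proof.
rewrite -cardsT -card_powerset subset_leq_card //.
by apply/subsetP => X _; rewrite powersetE subsetT.
Qed.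

Definition outer_nbrs (V : finType) (G : sgraph V) (A : {set V}) (v : V) :=
  [set w in ~: A | [set v; w] \in edges G].

(** A clique [X] is determined by [X :&: A] and [X :\: A]; the latter is empty
    or contained in [v |: outer_nbrs G A v] for any vertex [v] of it. *)
Lemma card_cliques (V : finType) (G : sgraph V) (A : {set V}) d :
    (forall v, v \notin A -> #|outer_nbrs G A v| < d) ->
  #|[set X | clique G X]| <= 2 ^ #|A| * (1 + #|V| * 2 ^ d).
Proof.
move=> degG; pose N v := v |: outer_nbrs G A v.
pose B := set0 |: \bigcup_(v in ~: A) powerset (N v).
have cardB : #|B| <= 1 + #|V| * 2 ^ d.
  apply: leq_trans (leq_card_setU _ _) _; rewrite cards1 leq_add2l.
  apply: leq_trans (_ : \sum_(v in ~: A) 2 ^ d <= _).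
    elim/big_ind2: _ => [|B1 n1 B2 n2 le1 le2|v]; first by rewrite cards0.
      exact: leq_trans (leq_card_setU _ _) (leq_add le1 le2).
    rewrite inE => /degG ltd; rewrite card_powerset leq_exp2l //.
    by apply: leq_trans ltd; rewrite cardsU1 -add1n leq_add2r leq_b1.
  by rewrite sum_nat_const leq_mul2r max_card orbT.
pose h (X : {set V}) := (X :&: A, X :\: A).
have injh : injective h by move=> X Y [eI eD]; rewrite -(setID X A) eI eD setID.
rewrite -(card_imset _ injh).
apply: leq_trans (_ : #|setX (powerset A) B| <= _); last first.
  by rewrite cardsX card_powerset leq_mul2l cardB orbT.
apply: subset_leq_card; apply/subsetP => _ /imsetP[X + ->].
rewrite inE => /forall_inP cX; rewrite !inE subsetIr /=.
have [//|/set0Pn[v vXA]] := eqVneq (X :\: A) set0.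
have /setDP[vX vA] := vXA.
apply/bigcupP; exists v; first by rewrite inE.
rewrite powersetE; apply/subsetP => w /setDP[wX wA]; rewrite !inE wA /=.
have [//|wv] := eqVneq w v; apply: cX; rewrite cards2 [v == w]eq_sym wv andbT.
by apply/subsetP => z /set2P[]->.
Qed.

(** * Cones over independent sets *)

Definition independent (W : finType) (F : sgraph W) (S : {set W}) : bool :=
  [forall e in edges F, ~~ (e \subset S)].

Lemma max_independent (W : finType) (F : sgraph W) :
  exists2 S, independent F S & forall T, independent F T -> #|T| <= #|S|.
Proof.
have ind0 : independent F set0.
  apply/forall_inP => e eF; rewrite subset0; apply/eqP => e0.
  by have := edge_card eF; rewrite e0 cards0.
by case: (arg_maxnP (fun S : {set W} => #|S|) ind0) => S; exists S.
Qed.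

Definition cone (V : finType) (A : {set V}) : sgraph V :=
  graph_of [set e : {set V} | ~~ [disjoint e & A]].

Lemma cone_free (V W : finType) (F : sgraph W) (A : {set V}) a :
    (forall T, independent F T -> #|T| <= a) -> #|A| + a < #|W| ->
  free F (cone A).
Proof.
move=> maxa ltA; apply: contraT => /not_freeP[f injf fE].
have /maxa : independent F (~: (f @^-1: A)).
  apply/forall_inP => e /fE; rewrite !inE.
  case/andP=> /pred0Pn[y /andP[/= fe yA]] _.
  have /imsetP[x xe defy] := fe; rewrite defy in yA; apply/subsetPn; exists x => //.
  by rewrite !inE negbK.
have leA : #|f @^-1: A| <= #|A|.
  rewrite -(card_imset _ injf); apply: subset_leq_card.
  by apply/subsetP => _ /imsetP[x + ->]; rewrite inE.
rewrite leqNgt cardsCs setCK ltn_subRL.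
by rewrite (leq_ltn_trans _ ltA) // leq_add2r.
Qed.

Lemma inj_into (W V : finType) (S : {set W}) (B : {set V}) (v0 : V) :
    #|S| <= #|B| ->
  exists2 g : W -> V, {in S &, injective g} & {in S, forall w, g w \in B}.
Proof.
move=> leSB; pose g w := nth v0 (enum B) (index w (enum S)).
have ltS w : w \in S -> index w (enum S) < size (enum B).
  by move=> wS; rewrite -cardE (leq_trans _ leSB) // cardE index_mem mem_enum.
exists g => [w w' wS w'S /eqP|w wS]; last by rewrite -mem_enum mem_nth ?ltS.
rewrite nth_uniq ?enum_uniq ?ltS // => /eqP eqi.
by apply: (index_inj w _ _ eqi); rewrite mem_enum.
Qed.

(** The set [S] together with one more vertex [x] of [F] spans only a star
    centred at [x], so [#|S|] neighbours of [v] outside [A] suffice to embed it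
    there; the edges of [F] with an end elsewhere come for free from the cone. *)
Lemma outer_degree (V W : finType) (F : sgraph W) (G : sgraph V)
    (S : {set W}) (A : {set V}) x v :
    free F G -> edges (cone A) \subset edges G -> independent F S ->
    x \notin S -> #|~: (x |: S)| <= #|A| -> v \notin A ->
  #|outer_nbrs G A v| < #|S|.
Proof.
move=> freeG /subsetP subG /forall_inP indS xS leA vA.
rewrite ltnNge; apply/negP => leS.
have [g injg gN] := inj_into v leS; have [h injh hA] := inj_into v leA.
pose f w := if w == x then v else if w \in S then g w else h w.
have fx : f x = v by rewrite /f eqxx.
have fS w : w \in S -> f w = g w.
  by rewrite /f; case: eqP => [->|_ ->] //; rewrite (negPf xS).
have fh w : w \in ~: (x |: S) -> f w = h w.
  by rewrite /f !inE negb_or => /andP[/negPf-> /negPf->].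
have fA w : (f w \in A) = (w \in ~: (x |: S)).
  apply/idP/idP => [|wO]; last by rewrite fh ?hA.
  apply: contraLR; rewrite !inE negbK => /orP[/eqP->|wS]; first by rewrite fx.
  by have := gN w wS; rewrite fS // !inE => /andP[].
have vNv : v \notin outer_nbrs G A v.
  rewrite inE setUid; apply/negP => /andP[_ /edge_card].
  by rewrite cards1.
have fxS w : w \in S -> f w != f x.
  move=> wS; rewrite fx fS //; apply: contraNneq vNv => {1}<-; exact: gN.
have injf : injective f.
  move=> w w' eqf.
  have := fA w; rewrite eqf fA => eqO.
  case wO: (w \in ~: (x |: S)).
    by apply: injh; rewrite -?fh // eqO.
  have w'O : w' \in ~: (x |: S) = false by rewrite eqO.
  move/negbT: wO; move/negbT: w'O; rewrite !inE !negbK.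
  case/orP=> [/eqP w'x|w'S] /orP[/eqP wx|wS].
  - by rewrite wx w'x.
  - by have := fxS w wS; rewrite eqf w'x eqxx.
  - by have := fxS w' w'S; rewrite -eqf wx eqxx.
  - by apply: injg; rewrite -?fS.
move: freeG; apply/negP/not_freeP; exists f => // e eF.
have [/subsetP sub|/subsetPn[w we wO]] := boolP (e \subset x |: S); last first.
  apply: subG; rewrite !inE card_imset // (edge_card eF) eqxx andbT.
  apply/pred0Pn; exists (f w); rewrite /= imset_f //=.
  by rewrite fA inE.
have xe : x \in e.
  apply: contraR (indS e eF) => xe; apply/subsetP => w we.
  by have := sub w we; rewrite !inE; case: eqP => // wx; rewrite -wx we in xe.
have /cards1P[w defe] : #|e :\ x| == 1.
  by rewrite -(eqn_add2l (x \in e)) -cardsD1 xe (edge_card eF).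
have /setD1P[wx we] : w \in e :\ x by rewrite defe set11.
have wS : w \in S by have := sub w we; rewrite !inE (negPf wx).
rewrite -(setD1K xe) defe imsetU1 imset_set1 fx fS //.
by have := gN w wS; rewrite inE => /andP[].
Qed.

(** * Linearly many cliques *)

Lemma edgeless_not_free (V W : finType) (F : sgraph W) (G : sgraph V) :
  edges F = set0 -> #|W| <= #|V| -> ~~ free F G.
Proof.
move=> F0 leWV; apply/not_freeP.
have [v0|V0] := pickP V.
  have [|g injg _] := inj_into (S := [set: W]) (B := [set: V]) v0.
    by rewrite !cardsT.
  by exists g => [w w' /injg|e]; [apply; rewrite inE | rewrite F0 inE].
have noW : W -> False.
  move=> w; move: leWV; rewrite (eq_card0 V0) leqNgt => /negP; apply.
  by apply/card_gt0P; exists w.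
exists (fun w => False_rect V (noW w)) => [w|e]; first by case: (noW w).
by rewrite F0 inE.
Qed.

(** For [n >= #|W|] no graph is saturated, and [sat] takes its default value
    0; the remaining values of [n] are bounded. *)
Lemma sat_edgeless (W : finType) r (F : sgraph W) n :
  edges F = set0 -> sat n (complete r) F <= 2 ^ #|W|.
Proof.
move=> F0; have [leWn|ltWn] := leqP #|W| n.
  rewrite /sat; case: pickP => // G /andP[freeG _].
  by have := edgeless_not_free G F0; rewrite card_ord freeG => /(_ leWn).
rewrite /sat; case: pickP => // G satG; case: arg_minnP => // G1 _ _.
apply: leq_trans (copies_complete r G1) (leq_trans (cliques_le G1) _).
by rewrite card_ord leq_exp2l // ltnW.
Qed.

Lemma sat_linear (W : finType) r (F : sgraph W) n :
  edges F != set0 ->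
  sat n (complete r) F <= 2 ^ #|W| * (1 + n * 2 ^ #|W|).
Proof.
case/set0Pn=> e0 e0F; have [S indS maxS] := max_independent F.
have [x xS] : exists x, x \notin S.
  have /subsetPn[x _ xS] := forall_inP indS e0 e0F.
  by exists x.
pose u := #|~: (x |: S)|.
have cardW : #|W| = u + #|S|.+1.
  by rewrite /u -(cardsC (x |: S)) cardsU1 xS addnC add1n.
pose A := [set i in take u (enum 'I_n)].
have cardA : #|A| = minn u n.
  rewrite cardsE (card_uniqP (take_uniq _ (enum_uniq _))).
  by rewrite size_take_min size_enum_ord.
have free0 : free F (cone A).
  apply: cone_free maxS _; rewrite cardA cardW addnS ltnS leq_add2r.
  exact: geq_minl.
have [G satG subG] := saturated_extension free0.
apply: leq_trans (sat_le_copies _ satG) (leq_trans (copies_complete _ _) _).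
have degG v : v \notin A -> #|outer_nbrs G A v| < #|S|.
  have [freeG _] := andP satG.
  move=> vA; apply: outer_degree freeG subG indS xS _ (vA).
  (* A vertex outside [A] exists only if [u <= n]. *)
  have : #|A| < n.
    rewrite -[n in _ < n]card_ord -cardsT proper_card // properT.
    by apply: contraNneq vA => ->; rewrite inE.
  by rewrite cardA gtn_min ltnn orbF leq_min leqnn => /ltnW.
apply: leq_trans (card_cliques degG) _; rewrite card_ord.
have leu : #|A| <= #|W| by rewrite cardA cardW geq_min leq_addr.
have leS : #|S| <= #|W| by apply: max_card.
by rewrite leq_mul ?leq_add2l ?leq_mul2l ?leq_exp2l // leS orbT.
Qed.

Theorem proposition1p4 (r : nat) (W : finType) (F : sgraph W) :
  2 <= r ->
  exists C : nat, forall n : nat, 1 <= n -> sat n (complete r) F < C * n.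
Proof.
move=> _; pose c := 2 ^ #|W|; exists (c * (1 + c)).+1 => n n_gt0.
suff le : sat n (complete r) F <= c * (1 + c) * n.
  by rewrite (leq_ltn_trans le) // ltn_pmul2r.
have [F0|F0] := eqVneq (edges F) set0.
  apply: leq_trans (sat_edgeless r n F0) _.
  by rewrite -mulnA leq_pmulr // muln_gt0 n_gt0.
apply: leq_trans (sat_linear r n F0) _.
by rewrite -mulnA leq_mul2l mulnDl mul1n [c * n]mulnC leq_add2r n_gt0 orbT.
Qed.
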